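(* If $S$ is a subtractive Dedekind semidomain, then $\mu_{*}(S)\leq 2$.
   Context: A semiring is $(S,+,\cdot,0,1)$ where $(S,+,0)$ and $(S,\cdot,1)$ are commutative monoids, $1\neq 0$, multiplication distributes over addition, and $a\cdot 0=0$ for all $a$. A semidomain is a semiring $S$ in which $ab=ac$ with $a\neq 0$ implies $b=c$. Its semifield of fractions $K=F(S)$ is the localization of $S$ at $S-\{0\}$. An ideal of $S$ is a nonempty subset closed under addition and under multiplication by elements of $S$. An ideal $I$ is subtractive if $a+b\in I$ and $a\in I$ imply $b\in I$ for all $a,b\in S$; a semiring is subtractive if each of its ideals is subtractive. A fractional ideal of $S$ is a nonempty subset $A\subseteq K$ closed under addition and under multiplication by elements of $S$ such that $dA\subseteq S$ for some nonzero $d\in S$. The product of fractional ideals $A,B$ is $AB=\{\sum_{i=1}^n a_ib_i: a_i\in A, b_i\in B\}$, and $A$ is invertible if $AB=S$ for some fractional ideal $B$. A Dedekind semidomain is a semidomain in which each nonzero fractional ideal is invertible. $\mu_{*}(S)$ denotes the supremum, over all ideals $I$ of $S$, of the minimum number of generators required to generate $I$. *)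

(* Defs.v *)
From HB Require Import structures.
From mathcomp Require Import all_boot all_order all_algebra.
From mathcomp Require Import generic_quotient ring.
From mathcomp Require Import classical_sets reals ereal.

Set Implicit Arguments.
Unset Strict Implicit.
Unset Printing Implicit Defensive.

Import Order.TTheory GRing.Theory Num.Theory.
Local Open Scope classical_set_scope.
Local Open Scope ring_scope.
Local Open Scope quotient_scope.

HB.mixin Record ComNzSemiRing_isSemidomain S of GRing.ComNzSemiRing S := {
  sdmulfI_subproof : forall a b c : S, a != 0 -> a * b = a * c -> b = c
}.

#[short(type="semidomainType")]
HB.structure Definition Semidomain :=
  {S of GRing.ComNzSemiRing S & ComNzSemiRing_isSemidomain S}.

Lemma sdmulfI (S : semidomainType) (a : S) : a != 0 -> injective ( *%R a).
Proof. by move=> a0 b c; apply: sdmulfI_subproof. Qed.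

Lemma sdmulf_neq0 (S : semidomainType) (a b : S) :
  a != 0 -> b != 0 -> a * b != 0.
Proof.
move=> a0; apply: contra_neq => ab0.
by apply: (sdmulfI a0); rewrite mulr0.
Qed.

(* The library's {fraction R} requires additive inverses, so the localization
   of S at S - {0} is built here, as a quotient of pairs (numerator, nonzero
   denominator). *)
Section SemifieldOfFractions.
Variable S : semidomainType.

Definition denom := {d : S | d != 0}.
HB.instance Definition _ := [isSub of denom for @sval _ _].
HB.instance Definition _ := [Choice of denom by <:].
Definition denom1 : denom := exist _ 1 (oner_neq0 S).
Definition denomM (s t : denom) : denom :=
  exist _ (val s * val t) (sdmulf_neq0 (valP s) (valP t)).

Definition sfrac_equiv (x y : S * denom) : bool :=
  x.1 * val y.2 == y.1 * val x.2.

Lemma sfrac_equiv_refl : reflexive sfrac_equiv.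
Proof. by move=> x; rewrite /sfrac_equiv. Qed.

Lemma sfrac_equiv_sym : symmetric sfrac_equiv.
Proof. by move=> x y; rewrite /sfrac_equiv eq_sym. Qed.

Lemma sfrac_equiv_trans : transitive sfrac_equiv.
Proof.
move=> [b t] [a s] [c u] /eqP /= ab /eqP /= bc; apply/eqP => /=.
apply: (sdmulfI (valP t)).
by rewrite mulrCA mulrA ab mulrAC bc -mulrA mulrCA mulrC mulrAC -mulrA mulrC.
Qed.

Canonical sfrac_equiv_equiv :=
  EquivRel sfrac_equiv sfrac_equiv_refl sfrac_equiv_sym sfrac_equiv_trans.

Definition sfrac := {eq_quot sfrac_equiv}.
HB.instance Definition _ : EqQuotient _ sfrac_equiv sfrac := EqQuotient.on sfrac.
HB.instance Definition _ := Choice.on sfrac.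

Definition mkfrac (a : S) (s : denom) : sfrac := \pi_sfrac (a, s).

Lemma mkfracE a s b t : mkfrac a s = mkfrac b t <-> a * val t = b * val s.
Proof.
split=> [/eqP|e]; first by rewrite /mkfrac eqmodE => /eqP.
by apply/eqP; rewrite /mkfrac eqmodE; apply/eqP.
Qed.

Lemma mkfracP (x : sfrac) : exists a s, x = mkfrac a s.
Proof. by elim/quotW: x => -[a s]; exists a, s. Qed.

Definition sfrac0 := mkfrac 0 denom1.
Definition sfrac1 := mkfrac 1 denom1.
Definition sfrac_add (x y : sfrac) : sfrac :=
  let: (a, s) := repr x in let: (b, t) := repr y in
  mkfrac (a * val t + b * val s) (denomM s t).
Definition sfrac_mul (x y : sfrac) : sfrac :=
  let: (a, s) := repr x in let: (b, t) := repr y in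
  mkfrac (a * b) (denomM s t).

Lemma repr_mkfrac a s :
  (repr (mkfrac a s)).1 * val s = a * val (repr (mkfrac a s)).2.
Proof.
by apply/mkfracE; rewrite /mkfrac -surjective_pairing reprK.
Qed.

Lemma sfrac_addE a s b t : sfrac_add (mkfrac a s) (mkfrac b t) =
  mkfrac (a * val t + b * val s) (denomM s t).
Proof.
rewrite /sfrac_add; move: (repr_mkfrac a s) (repr_mkfrac b t).
case: (repr _) => a' s' /= e1; case: (repr _) => b' t' /= e2.
apply/mkfracE => /=.
transitivity ((a' * sval s) * (sval t' * sval t) +
  (b' * sval t) * (sval s' * sval s)); first ring.
by rewrite e1 e2; ring.
Qed.

Lemma sfrac_mulE a s b t : sfrac_mul (mkfrac a s) (mkfrac b t) =
  mkfrac (a * b) (denomM s t).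
Proof.
rewrite /sfrac_mul; move: (repr_mkfrac a s) (repr_mkfrac b t).
case: (repr _) => a' s' /= e1; case: (repr _) => b' t' /= e2.
apply/mkfracE => /=.
transitivity ((a' * sval s) * (b' * sval t)); first ring.
by rewrite e1 e2; ring.
Qed.

Lemma sfrac_addA : associative sfrac_add.
Proof.
move=> x y z; have [a [s ->]] := mkfracP x; have [b [t ->]] := mkfracP y.
have [c [u ->]] := mkfracP z; rewrite !sfrac_addE; apply/mkfracE => /=; ring.
Qed.

Lemma sfrac_addC : commutative sfrac_add.
Proof.
move=> x y; have [a [s ->]] := mkfracP x; have [b [t ->]] := mkfracP y.
rewrite !sfrac_addE; apply/mkfracE => /=; ring.
Qed.

Lemma sfrac_add0 : left_id sfrac0 sfrac_add.
Proof.
move=> x; have [a [s ->]] := mkfracP x.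
rewrite !sfrac_addE; apply/mkfracE => /=; ring.
Qed.

Lemma sfrac_mulA : associative sfrac_mul.
Proof.
move=> x y z; have [a [s ->]] := mkfracP x; have [b [t ->]] := mkfracP y.
have [c [u ->]] := mkfracP z; rewrite !sfrac_mulE; apply/mkfracE => /=; ring.
Qed.

Lemma sfrac_mulC : commutative sfrac_mul.
Proof.
move=> x y; have [a [s ->]] := mkfracP x; have [b [t ->]] := mkfracP y.
rewrite !sfrac_mulE; apply/mkfracE => /=; ring.
Qed.

Lemma sfrac_mul1 : left_id sfrac1 sfrac_mul.
Proof.
move=> x; have [a [s ->]] := mkfracP x.
rewrite !sfrac_mulE; apply/mkfracE => /=; ring.
Qed.

Lemma sfrac_mulDl : left_distributive sfrac_mul sfrac_add.
Proof.
move=> x y z; have [a [s ->]] := mkfracP x; have [b [t ->]] := mkfracP y.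
have [c [u ->]] := mkfracP z.
rewrite !(sfrac_mulE, sfrac_addE); apply/mkfracE => /=; ring.
Qed.

Lemma sfrac_mul0 : left_zero sfrac0 sfrac_mul.
Proof.
move=> x; have [a [s ->]] := mkfracP x.
rewrite !sfrac_mulE; apply/mkfracE => /=; ring.
Qed.

Lemma sfrac1_neq0 : sfrac1 != sfrac0.
Proof.
apply/eqP => /mkfracE /eqP /=; rewrite mulr1 mul0r.
exact/negP/oner_neq0.
Qed.

HB.instance Definition _ :=
  GRing.isNmodule.Build sfrac sfrac_addA sfrac_addC sfrac_add0.
HB.instance Definition _ := GRing.Nmodule_isComNzSemiRing.Build sfrac
  sfrac_mulA sfrac_mulC sfrac_mul1 sfrac_mulDl sfrac_mul0 sfrac1_neq0.

Definition tosfrac (a : S) : sfrac := mkfrac a denom1.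

Lemma tosfrac_is_nmod_morphism : nmod_morphism tosfrac.
Proof.
split=> // a b; rewrite [RHS]sfrac_addE; apply/mkfracE => /=; ring.
Qed.

Lemma tosfrac_is_monoid_morphism : monoid_morphism tosfrac.
Proof.
split=> // a b; rewrite [RHS]sfrac_mulE; apply/mkfracE => /=; ring.
Qed.

HB.instance Definition _ :=
  GRing.isNmodMorphism.Build S sfrac tosfrac tosfrac_is_nmod_morphism.
HB.instance Definition _ :=
  GRing.isMonoidMorphism.Build S sfrac tosfrac tosfrac_is_monoid_morphism.

Lemma tosfrac_inj : injective tosfrac.
Proof. by move=> a b /mkfracE /=; rewrite !mulr1. Qed.

Lemma mkfrac_mul_denom a s : mkfrac a s * tosfrac (val s) = tosfrac a.
Proof. rewrite [LHS]sfrac_mulE; apply/mkfracE => /=; ring. Qed.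

Lemma sfrac_mulVf (x : sfrac) : x != 0 -> exists y, y * x = 1.
Proof.
have [a [s ->]] := mkfracP x => x0.
have a0 : a != 0.
  apply: contra_neq x0 => ->; apply/mkfracE => /=; ring.
exists (mkfrac (val s) (exist _ a a0)).
rewrite [LHS]sfrac_mulE; apply/mkfracE => /=; ring.
Qed.

End SemifieldOfFractions.

Section Ideals.
Variable S : comNzSemiRingType.

Definition is_ideal (I : set S) : Prop :=
  [/\ I !=set0,
      forall a b, I a -> I b -> I (a + b)
    & forall s a, I a -> I (s * a)].

Definition subtractive_ideal (I : set S) : Prop :=
  forall a b, I (a + b) -> I a -> I b.

Definition subtractive : Prop :=
  forall I : set S, is_ideal I -> subtractive_ideal I.

Definition ideal_gen (X : set S) : set S := smallest is_ideal X.

(* Minimum number of generators of I, with value +oo when I is not finitely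
   generated (the infimum of the empty set). R only provides the codomain
   \bar R, in which infima and suprema of sets always exist. *)
Definition mu (R : realType) (I : set S) : \bar R :=
  ereal_inf [set ((size X)%:R)%:E | X in [set X : seq S | ideal_gen [set` X] = I]].

Definition mu_star (R : realType) : \bar R :=
  ereal_sup [set mu R I | I in [set I : set S | is_ideal I]].

End Ideals.

Section FractionalIdeals.
Variable S : semidomainType.
Local Notation K := (sfrac S).

Definition is_fractional_ideal (A : set K) : Prop :=
  [/\ A !=set0,
      forall x y, A x -> A y -> A (x + y),
      forall (s : S) x, A x -> A (tosfrac s * x)
    & exists2 d : S, d != 0 &
        [set tosfrac d * x | x in A] `<=` range (@tosfrac S)].

Definition fideal_mul (A B : set K) : set K :=
  [set x | exists n (a b : 'I_n -> K),
     [/\ forall i, A (a i), forall i, B (b i) & x = \sum_(i < n) a i * b i]].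

Definition invertible_fideal (A : set K) : Prop :=
  exists2 B, is_fractional_ideal B & fideal_mul A B = range (@tosfrac S).

Definition dedekind_semidomain : Prop :=
  forall A : set K, is_fractional_ideal A -> A <> [set 0] -> invertible_fideal A.

End FractionalIdeals.

Arguments subtractive S : clear implicits.
Arguments mu_star S R : clear implicits.
Arguments dedekind_semidomain S : clear implicits.

(* Main.v *)
Require Import Defs.
From mathcomp Require Import all_boot all_order all_algebra.
From mathcomp Require Import ring.
From mathcomp Require Import boolp classical_sets reals ereal.

(** Invertibility makes ideals cancellable, makes containment the same as
    divisibility, and makes [S] noetherian; hence every nonzero ideal contains
    a product of maximal ideals, and any maximal ideal containing it is one of
    the factors.  Given a nonzero [a] in [I], write [aS = IJ] and let [Ps] be
    such factors for [J].  Subtractivity is what allows one to choose [b] in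
    [I] outside every [IP] with [P] in [Ps]: adding an element of [IP] to an
    element outside [IP] leaves it outside.  Writing [bS = IC], no maximal ideal
    contains [J + C], so [aS + bS = I(J + C) = I]. *)

Local Open Scope classical_set_scope.
Local Open Scope ring_scope.

(** * Ideals of a commutative semiring: sums and products *)

Section IdealArithmetic.
Local Set Implicit Arguments.
Local Unset Strict Implicit.
Import GRing.Theory.
Variable S : comNzSemiRingType.
Implicit Types (I J A B C M : set S) (a b x : S).

Lemma ideal0 I : is_ideal I -> I 0.
Proof. by case=> -[x Ix] _ /(_ 0 x Ix); rewrite mul0r. Qed.

Lemma idealD I a b : is_ideal I -> I a -> I b -> I (a + b).
Proof. by case=> _ + _; apply. Qed.

Lemma idealMl I s a : is_ideal I -> I a -> I (s * a).
Proof. by case=> _ _; apply. Qed.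

Lemma idealMr I s a : is_ideal I -> I a -> I (a * s).
Proof. by rewrite mulrC; apply: idealMl. Qed.

Lemma idealT : is_ideal [set: S].
Proof. by split=> //; exists 0. Qed.

Lemma ideal1T I : is_ideal I -> I 1 -> I = setT.
Proof.
move=> iI I1; apply/seteqP; split=> // x _.
by rewrite -[x]mulr1; apply: idealMl.
Qed.

Lemma ideal_gen_ideal (X : set S) : is_ideal (ideal_gen X).
Proof.
split.
- by exists 0 => I [iI _]; apply: ideal0.
- by move=> a b Xa Xb I IX; apply: idealD; [case: IX | apply: Xa | apply: Xb].
- by move=> s a Xa I IX; apply: idealMl; [case: IX | apply: Xa].
Qed.

Lemma ideal_gen_sub (X I : set S) : is_ideal I -> X `<=` I -> ideal_gen X `<=` I.
Proof. by move=> iI XI x; apply. Qed.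

Lemma sub_ideal_gen (X : set S) : X `<=` ideal_gen X.
Proof. by move=> x Xx I [_]; apply. Qed.

(** Lets a claim about [d * x], with [d] in a product of ideals, be checked on the products [u * v]
    that generate it. *)
Lemma ideal_preimage_mul x I : is_ideal I -> is_ideal [set y | I (y * x)].
Proof.
move=> iI; split=> /=; first by exists 0; rewrite /= mul0r; apply: ideal0.
  by move=> a b; rewrite mulrDl; apply: idealD.
by move=> s a; rewrite -mulrA; apply: idealMl.
Qed.

Lemma ideal_image_mul d I : is_ideal I -> is_ideal [set d * x | x in I].
Proof.
move=> iI; split=> /=; first by exists (d * 0), 0 => //; apply: ideal0.
  move=> _ _ [x Ix <-] [y Iy <-]; exists (x + y); first exact: idealD.
  by rewrite mulrDr.
by move=> s _ [x Ix <-]; exists (s * x); [apply: idealMl | rewrite mulrCA].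
Qed.

Definition ideal_add A B : set S := [set x + y | x in A & y in B].

Lemma ideal_add_ideal A B : is_ideal A -> is_ideal B -> is_ideal (ideal_add A B).
Proof.
move=> iA iB; split.
- by exists (0 + 0), 0; [apply: ideal0 | exists 0 => //; apply: ideal0].
- move=> _ _ [x Ax [y By <-]] [z Az [t Bt <-]]; exists (x + z); first exact: idealD.
  by exists (y + t); [apply: idealD | rewrite addrACA].
- move=> s _ [x Ax [y By <-]]; exists (s * x); first exact: idealMl.
  by exists (s * y); [apply: idealMl | rewrite mulrDr].
Qed.

Lemma ideal_addl A B : is_ideal B -> A `<=` ideal_add A B.
Proof.
by move=> iB x Ax; exists x => //; exists 0; [apply: ideal0 | rewrite addr0].
Qed.

Lemma ideal_addr A B : is_ideal A -> B `<=` ideal_add A B.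
Proof.
by move=> iA x Bx; exists 0; [apply: ideal0 | exists x => //; rewrite add0r].
Qed.

Definition ideal_mul A B : set S := ideal_gen [set x * y | x in A & y in B].

Lemma ideal_mul_ideal A B : is_ideal (ideal_mul A B).
Proof. exact: ideal_gen_ideal. Qed.

Lemma mem_ideal_mul A B x y : A x -> B y -> ideal_mul A B (x * y).
Proof. by move=> Ax By; apply: sub_ideal_gen; exists x => //; exists y. Qed.

Lemma ideal_mul_sub A B C : is_ideal C ->
  (forall x y, A x -> B y -> C (x * y)) -> ideal_mul A B `<=` C.
Proof.
by move=> iC ABC; apply: ideal_gen_sub => // _ [x Ax [y By <-]]; apply: ABC.
Qed.

Lemma ideal_mulS A B C : B `<=` C -> ideal_mul A B `<=` ideal_mul A C.
Proof.
move=> BC; apply: ideal_mul_sub => [|x y Ax By]; first exact: ideal_mul_ideal.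
by apply: mem_ideal_mul => //; apply: BC.
Qed.

Lemma ideal_mul_subl A B : is_ideal A -> ideal_mul A B `<=` A.
Proof. by move=> iA; apply: ideal_mul_sub => // x y Ax _; apply: idealMr. Qed.

Lemma ideal_mul_subr A B : is_ideal B -> ideal_mul A B `<=` B.
Proof. by move=> iB; apply: ideal_mul_sub => // x y _ By; apply: idealMl. Qed.

(** * Maximal ideals and their products *)

Definition maximal_ideal M : Prop :=
  [/\ is_ideal M, ~ M 1
    & forall I, is_ideal I -> M `<=` I -> ~ I 1 -> I `<=` M].

(** If [a] lies outside [M], maximality gives [m + a * s = 1] with [m] in [M]; multiplying by [b]
    puts [b] in [M]. *)
Lemma maximal_ideal_prime M a b :
  maximal_ideal M -> M (a * b) -> M a \/ M b.
Proof.
move=> [iM M1 Mmax] Mab; have [Ma|nMa] := pselect (M a); [by left | right].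
have iN := ideal_add_ideal iM (ideal_image_mul a idealT).
have [[m Mm [_ [s _ <-] e]]|N1] :=
  pselect (ideal_add M [set a * s | s in setT] 1).
  rewrite -[b]mul1r -e mulrDl mulrAC.
  by apply: (idealD iM); apply: idealMr.
case: nMa; apply: (Mmax _ iN) => //.
  exact/ideal_addl/ideal_image_mul/idealT.
by apply: ideal_addr => //; exists 1 => //; rewrite mulr1.
Qed.

Lemma maximal_ideal_eq M P :
  maximal_ideal M -> maximal_ideal P -> P `<=` M -> P = M.
Proof.
by move=> [iM M1 _] [iP _ Pmax] PM; apply/seteqP; split=> //; apply: Pmax.
Qed.

Definition ideal_prod (Ps : seq (set S)) : set S := foldr ideal_mul setT Ps.

Lemma ideal_prod_ideal Ps : is_ideal (ideal_prod Ps).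
Proof. by case: Ps => [|P Ps]; [apply: idealT | apply: ideal_mul_ideal]. Qed.

(** By primality: if some [p] in the head [P] lies outside [M], then [p * x] in [M] forces every [x]
    of the remaining product into [M]. *)
Lemma maximal_ideal_prod M Ps : maximal_ideal M ->
  List.Forall maximal_ideal Ps -> ideal_prod Ps `<=` M -> List.In M Ps.
Proof.
move=> maxM; elim: Ps => [|P Ps IHPs] /= maxPs PsM.
  by case: maxM => _ + _; apply; apply: PsM.
have [maxP {}maxPs] : maximal_ideal P /\ List.Forall maximal_ideal Ps.
  by move: maxPs => /List.Forall_cons_iff.
have [PM|/existsNP[p /not_implyP[Pp nMp]]] := pselect (P `<=` M).
  by left; apply: maximal_ideal_eq.
right; apply: IHPs => // x Psx.
by have [] := maximal_ideal_prime maxM (PsM _ (mem_ideal_mul Pp Psx)).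
Qed.

Lemma ideal_prod_sub P Ps :
  List.Forall maximal_ideal Ps -> List.In P Ps -> ideal_prod Ps `<=` P.
Proof.
elim: Ps => [|Q Ps IHPs] //= /List.Forall_cons_iff[maxQ maxPs] [<-|PPs].
  by apply: ideal_mul_subl; case: maxQ.
apply: subset_trans (IHPs maxPs PPs).
by apply: ideal_mul_subr; apply: ideal_prod_ideal.
Qed.

(** * Noetherian semirings *)

Definition noetherian : Prop := forall I, is_ideal I ->
  exists2 X : seq S, [set` X] `<=` I & I `<=` ideal_gen [set` X].

(** Induction along reverse inclusion. A counterexample starts a strictly increasing chain of
    counterexamples, whose union is finitely generated and hence equal to one of its terms. *)
Lemma noetherian_ind (Q : set S -> Prop) : noetherian ->
  (forall I, is_ideal I ->
     (forall J, is_ideal J -> I `<` J -> Q J) -> Q I) ->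
  forall I, is_ideal I -> Q I.
Proof.
move=> noeth IH I0 iI0; apply: contrapT => nQI0.
pose T := {I : set S | is_ideal I /\ ~ Q I}.
have step (t : T) : {u : T | sval t `<` sval u}.
  apply: cid; case: t => I [iI nQI] /=; apply: contrapT => noJ.
  apply: nQI; apply: IH => // J iJ IJ; apply: contrapT => nQJ.
  by apply: noJ; exists (exist _ J (conj iJ nQJ)).
pose f n : set S := sval (iter n (fun t => sval (step t))
  (exist _ I0 (conj iI0 nQI0) : T)).
have f_ideal n : is_ideal (f n) by rewrite /f; case: (iter _ _ _) => I [].
have f_lt n : f n `<` f n.+1 by rewrite /f /=; case: (step _).
have f_le m n : (m <= n)%N -> f m `<=` f n.
  move=> /subnKC <-; elim: (n - m)%N => [|k IHk]; first by rewrite addn0.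
  by rewrite addnS; apply: subset_trans IHk _; case: (f_lt (m + k)%N).
pose U := [set x | exists n, f n x].
have iU : is_ideal U.
  split; first by exists 0, 0%N; apply: ideal0.
    move=> a b [m fa] [n fb]; exists (maxn m n); apply: idealD => //.
      exact: f_le (leq_maxl _ _) _ fa.
    exact: f_le (leq_maxr _ _) _ fb.
  by move=> s a [n fa]; exists n; apply: idealMl.
have [X XU UX] := noeth U iU.
(* Each generator lies in some term, and the largest of the indices serves them all. *)
have [n Xn] : exists n, [set` X] `<=` f n.
  elim: X XU {UX} => [|x X IHX] XU; first by exists 0%N.
  have [|m Xm] := IHX; first by move=> y Xy; apply: XU; rewrite /= inE Xy orbT.
  have [n fx] : U x by apply: XU; rewrite /= mem_head.
  exists (maxn m n) => y; rewrite /= inE => /orP[/eqP->|Xy].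
    exact: f_le (leq_maxr _ _) _ fx.
  exact: f_le (leq_maxl _ _) _ (Xm y Xy).
have [_] := f_lt n; apply=> y fy.
by apply: ideal_gen_sub Xn _ _ => //; apply: UX; exists n.+1.
Qed.

Lemma noetherian_maximal_ideal I : noetherian -> is_ideal I -> ~ I 1 ->
  exists2 M, maximal_ideal M & I `<=` M.
Proof.
move=> noeth; move: I; refine (noetherian_ind noeth _) => I iI IH I1.
have [maxI|nmaxI] := pselect (maximal_ideal I); first by exists I.
have [J [iJ IJ J1]] : exists J, [/\ is_ideal J, I `<` J & ~ J 1].
  apply: contrapT => noJ; apply: nmaxI; split=> // J iJ IJ J1.
  by apply: contrapT => nJI; apply: noJ; exists J; split=> //; split.
have [M maxM JM] := IH J iJ IJ J1; exists M => //.
by apply: subset_trans JM; case: IJ.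
Qed.

End IdealArithmetic.

(** * Inverses of ideals in a semidomain *)

Section DedekindSemidomain.
Local Set Implicit Arguments.
Local Unset Strict Implicit.
Import GRing.Theory.
Variable S : semidomainType.
Implicit Types (I J A B C M P Q : set S) (a b d x : S).

(** [J / d] is the inverse of [I] as a fractional ideal: the last two clauses say that [1] lies in
    [I (J / d)] and that [I (J / d)] lies in [S]. Clearing the denominator keeps later arguments
    inside [S]. *)
Definition ideal_inverse I J d : Prop :=
  [/\ is_ideal J, d != 0, ideal_mul I J d
    & forall x y, I x -> J y -> exists s, x * y = d * s].

(** Embed [I] in the semifield of fractions, take the inverse [B] of its image and a nonzero [d]
    with [d B] in [S], and put [J = d B]. *)
Lemma dedekind_inverse I a : dedekind_semidomain S ->
  is_ideal I -> I a -> a != 0 -> exists J d, ideal_inverse I J d.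
Proof.
move=> dedS iI Ia a0; pose A := [set tosfrac x | x in I].
have fracA : is_fractional_ideal A.
  split; first by exists (tosfrac a), a.
  - move=> _ _ [x Ix <-] [y Iy <-]; exists (x + y); first exact: idealD.
    exact: rmorphD.
  - move=> s _ [x Ix <-]; exists (s * x); first exact: idealMl.
    exact: rmorphM.
  - exists 1; first exact: oner_neq0.
    by move=> _ [_ [x _ <-] <-]; exists (1 * x) => //; rewrite rmorphM.
have A0 : A <> [set 0].
  move=> A0; have : A (tosfrac a) by exists a.
  rewrite A0 /= -(rmorph0 (@tosfrac S)) => /tosfrac_inj a0'.
  by rewrite a0' eqxx in a0.
have [B [_ BD BM [d d0 dB]] AB] := dedS A fracA A0.
pose J := [set y | exists2 b, B b & tosfrac y = tosfrac d * b].
have JP (b : sfrac S) : B b -> exists2 y, J y & tosfrac y = tosfrac d * b.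
  move=> Bb; have [|y _ e] := dB (tosfrac d * b); first by exists b.
  by exists y => //; exists b.
have ABB (x y : sfrac S) : A x -> B y -> exists s, x * y = tosfrac s.
  move=> Ax By; have : fideal_mul A B (x * y).
    exists 1%N, (fun=> x), (fun=> y); split=> //.
    by rewrite big_ord1.
  by rewrite AB => -[s _ <-]; exists s.
have [n [u [v [Au Bv one]]]] : fideal_mul A B 1.
  by rewrite AB; exists 1 => //; apply: rmorph1.
exists J, d; split=> //.
- split.
  + have [b Bb] : B !=set0.
      case: n u v Au Bv one => [|n] u v _ Bv one; last by exists (v ord0).
      by move: one; rewrite big_ord0 => /eqP; rewrite oner_eq0.
    by have [y Jy _] := JP b Bb; exists y.
  + move=> x y [b Bb ex] [c Bc ey]; exists (b + c); first exact: BD.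
    by rewrite rmorphD mulrDr; congr (_ + _).
  + move=> s x [b Bb ex]; exists (tosfrac s * b); first exact: BM.
    by rewrite rmorphM /= ex mulrCA.
- have iIJ := ideal_mul_ideal I J.
  pose x i := sval (cid2 (Au i)).
  pose y i := sval (cid2 (JP _ (Bv i))).
  (* This is the expression of [1] as the sum of the [u i * v i], multiplied by [d]: [x i] and [y i]
     map to [u i] and [d * v i]. *)
  have -> : d = \sum_(i < n) x i * y i.
    apply: (@tosfrac_inj S); rewrite rmorph_sum -[LHS]mulr1 one mulr_sumr.
    apply: eq_bigr => i _; rewrite /x /y rmorphM /=.
    case: (cid2 (Au i)) => /= xi _ ->; case: cid2 => /= yi _ ->.
    by rewrite mulrCA.
  elim/big_ind: _ => [|p q|i _]; [exact: ideal0 | exact: idealD |].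
  apply: mem_ideal_mul; rewrite /x /y; first by case: (cid2 (Au i)).
  by case: (cid2 (JP _ _)).
- move=> x y Ix [b Bb ey]; have [|s es] := ABB (tosfrac x) b _ Bb.
    by exists x.
  exists s; apply: (@tosfrac_inj S).
  by rewrite !rmorphM /= ey -es mulrCA.
Qed.

Section Inverse.
Variables (I J : set S) (d : S).
Hypothesis invI : ideal_inverse I J d.

(** Multiply by [J]: [d A] lies in [I J A], hence in [I J B], hence in [d B]; then [d] cancels. *)
Lemma ideal_mul_cancel A B : is_ideal B ->
  ideal_mul I A `<=` ideal_mul I B -> A `<=` B.
Proof.
have [_ d0 IJd IJdS] := invI => iB IAB x Ax.
have idB := ideal_image_mul d iB.
suff [y By /(sdmulfI d0)<-] : [set d * y | y in B] (d * x) by [].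
refine (ideal_mul_sub (ideal_preimage_mul x idB) _ IJd).
move=> u v Iu Jv /=; rewrite mulrAC.
have IBux : ideal_mul I B (u * x) by apply: IAB; apply: mem_ideal_mul.
refine (ideal_mul_sub (ideal_preimage_mul v idB) _ IBux).
move=> w b Iw Bb /=; have [s ws] := IJdS w v Iw Jv.
by exists (s * b); [apply: idealMl | rewrite mulrA -ws mulrAC].
Qed.

Lemma ideal_dvd A : is_ideal A -> A `<=` I ->
  exists2 C, is_ideal C & A = ideal_mul I C.
Proof.
have [_ d0 IJd IJdS] := invI => iA AI.
(* The witness is [A J / d], the product of [A] with the inverse of [I]; as [A] lies in [I], the
   products generating [A J] are multiples of [d]. *)
exists [set c | ideal_mul A J (c * d)].
  exact/ideal_preimage_mul/ideal_mul_ideal.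
apply/seteqP; split=> [x Ax|].
  set C := [set c | _].
  have idIC := ideal_image_mul d (ideal_mul_ideal I C).
  suff [y ICy /(sdmulfI d0)<-] :
    [set d * y | y in ideal_mul I C] (d * x) by [].
  refine (ideal_mul_sub (ideal_preimage_mul x idIC) _ IJd).
  move=> u v Iu Jv /=; have [s xs] := IJdS x v (AI x Ax) Jv.
  exists (u * s); last by rewrite mulrCA -xs mulrAC mulrA.
  apply: mem_ideal_mul => //; rewrite /C /= mulrC -xs.
  exact: mem_ideal_mul.
apply: ideal_mul_sub => // m c Im /= AJcd.
have idA := ideal_image_mul d iA.
(* Here [c * d] is in [A J], and multiplying [A J] by [m] in [I] lands in [d A]. *)
suff [y Ay /(sdmulfI d0)<-] : [set d * y | y in A] (d * (m * c)) by [].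
have -> : d * (m * c) = (c * d) * m by ring.
refine (ideal_mul_sub (ideal_preimage_mul m idA) _ AJcd).
move=> a v Aa Jv /=; have [s ms] := IJdS m v Im Jv.
exists (s * a); first exact: idealMl.
by rewrite mulrA -ms; ring.
Qed.

(** Write [d] as a sum of products [u_i * v_i]. The [u_i] generate [I], since [d * x] is the sum of
    the [u_i * (v_i * x)] and each [v_i * x] is a multiple of [d]. *)
Lemma ideal_inverse_fg : is_ideal I ->
  exists2 X : seq S, [set` X] `<=` I & I `<=` ideal_gen [set` X].
Proof.
have [_ d0 IJd IJdS] := invI => iI.
(* The list [X] is collected through the ideal [T], which contains every [u * v] and hence [d]. *)
pose T := [set y | exists2 X : seq S, [set` X] `<=` I & forall x, I x ->
  exists2 z, ideal_gen [set` X] z & y * x = d * z].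
have genS (X Y : seq S) : [set` X] `<=` [set` Y] ->
    ideal_gen [set` X] `<=` ideal_gen [set` Y].
  move=> XY; apply: ideal_gen_sub; first exact: ideal_gen_ideal.
  exact: subset_trans XY (@sub_ideal_gen _ _).
have iT : is_ideal T.
  split.
  - exists 0, [::] => // x _; exists 0; last by rewrite mul0r mulr0.
    exact: (ideal0 (ideal_gen_ideal _)).
  - move=> a b [X XI aX] [Y YI bY]; exists (X ++ Y).
      by move=> x; rewrite /= mem_cat => /orP[/XI|/YI].
    move=> x Ix; have [z Xz az] := aX x Ix; have [t Yt bt] := bY x Ix.
    exists (z + t); last by rewrite mulrDl az bt mulrDr.
    apply: (idealD (ideal_gen_ideal _)).
      by apply: genS Xz => w /= Xw; rewrite mem_cat Xw.
    by apply: genS Yt => w /= Yw; rewrite mem_cat Yw orbT.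
  - move=> s a [X XI aX]; exists X => // x Ix; have [z Xz az] := aX x Ix.
    exists (s * z); first by apply: (idealMl _ (ideal_gen_ideal _)).
    by rewrite -mulrA az mulrCA.
have [X XI dX] : T d.
  apply: ideal_mul_sub IJd => // u v Iu Jv; exists [:: u].
    by move=> x; rewrite /= inE => /eqP->.
  move=> x Ix; have [s xs] := IJdS x v Ix Jv; exists (s * u).
    apply: (idealMl _ (ideal_gen_ideal _)).
    by apply: sub_ideal_gen; rewrite /= mem_head.
  by rewrite mulrA -xs; ring.
exists X => // x Ix; have [z Xz] := dX x Ix.
by move=> /(sdmulfI d0)->.
Qed.

End Inverse.

(** * Maximal ideals and generators in a subtractive Dedekind semidomain *)

Hypotheses (subS : subtractive S) (dedS : dedekind_semidomain S).

Lemma dedekind_noetherian : noetherian S.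
Proof.
move=> I iI; have [I0|/existsNP[a /not_implyP[Ia a0]]] :=
    pselect (forall a, I a -> a = 0).
  by exists [::] => // x /I0 ->; apply: (ideal0 (ideal_gen_ideal _)).
have [J [d invI]] := dedekind_inverse dedS iI Ia (introN eqP a0).
exact: ideal_inverse_fg invI iI.
Qed.

(** Noetherian induction: a proper [I] lies in a maximal [M], so [I = M C], and the induction
    hypothesis applies to [C], which is strictly larger than [I]. *)
Lemma dedekind_ideal_prod I a : is_ideal I -> I a -> a != 0 ->
  exists2 Ps, List.Forall (@maximal_ideal S) Ps & ideal_prod Ps `<=` I.
Proof.
(* The nonzero [a] stays fixed: it lies in every larger ideal, so all ideals met have inverses. *)
move=> iI Ia a0; move: I iI Ia.
refine (noetherian_ind dedekind_noetherian _) => I iI IH Ia.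
have [I1|nI1] := pselect (I 1); first by exists [::]; rewrite ?(ideal1T iI I1).
have [M maxM IM] := noetherian_maximal_ideal dedekind_noetherian iI nI1.
have [iM nM1 _] := maxM.
have [M' [d invM]] := dedekind_inverse dedS iM (IM a Ia) a0.
have [C iC eI] := ideal_dvd invM iI IM.
have IC : I `<=` C by rewrite eI; apply: ideal_mul_subr.
have [I' [d' invI]] := dedekind_inverse dedS iI Ia a0.
(* [C = I] would give [I = M I], and cancelling [I] would give [M = S]. *)
have CI : ~ C `<=` I.
  move=> CI; have eC : C = I by apply/seteqP.
  apply: nM1; have : [set: S] `<=` M; last exact.
  refine (ideal_mul_cancel invI iM _).
  apply: subset_trans (@ideal_mul_subl _ _ _ iI) _.
  rewrite [X in X `<=` _]eI eC; apply: ideal_mul_sub; first exact: ideal_mul_ideal.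
  by move=> x y Mx Iy; rewrite mulrC; apply: mem_ideal_mul.
have [Ps maxPs PsC] := IH C iC (conj IC CI) (IC a Ia).
exists (M :: Ps); first by constructor.
by rewrite eI; apply: ideal_mulS.
Qed.

(** Induction on [Ps]: if the [b] found for the tail falls into [I Q], it is corrected by an element
    [c] that lies in every [I P] of the tail but not in [I Q]. *)
Lemma avoid_maximal_ideals I a Ps : is_ideal I -> I a -> a != 0 ->
  List.Forall (@maximal_ideal S) Ps ->
  exists2 b, I b & forall P, List.In P Ps -> ~ ideal_mul I P b.
Proof.
move=> iI Ia a0; have [J [d invI]] := dedekind_inverse dedS iI Ia a0.
elim: Ps => [|Q Ps IHPs]; first by exists a.
move=> /List.Forall_cons_iff[maxQ maxPs]; have [b Ib bPs] := IHPs maxPs.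
have [IQb|nIQb] := pselect (ideal_mul I Q b); last first.
  by exists b => // P [<-|/bPs].
(* Since [b] is in [I Q], [Q] does not occur in [Ps] and so does not contain their product;
   cancelling [I] yields [c]. *)
have [c [Ic nIQc]] :
    exists c, ideal_mul I (ideal_prod Ps) c /\ ~ ideal_mul I Q c.
  apply: contrapT => noc; apply: (bPs Q) => //.
  apply: maximal_ideal_prod => //; have [iQ _ _] := maxQ.
  refine (ideal_mul_cancel invI iQ _).
  by move=> c Ic; apply: contrapT => nIQc; apply: noc; exists c.
exists (b + c).
  apply: idealD => //; exact: ideal_mul_subl Ic.
(* Subtractivity is applied twice: [b] is in [I Q] and [c] is not; for [P] in [Ps], [c] is in [I P]
   and [b] is not. *)
move=> P [<-|PPs] IPbc.
  by apply: nIQc; apply: subS IPbc IQb; apply: ideal_mul_ideal.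
apply: (bPs P) => //; rewrite addrC in IPbc.
apply: subS IPbc _; first exact: ideal_mul_ideal.
exact: ideal_mulS (ideal_prod_sub maxPs PPs) _ Ic.
Qed.

Lemma dedekind_two_generators I : is_ideal I ->
  exists a b, ideal_gen [set` [:: a; b]] = I.
Proof.
move=> iI; have [I0|/existsNP[a /not_implyP[Ia /eqP a0]]] :=
    pselect (forall a, I a -> a = 0).
  (* The zero ideal: [0] is repeated because the list has length two. *)
  exists 0, 0; apply/seteqP; split=> [|x /I0->].
    apply: ideal_gen_sub => // x; rewrite /= !inE orbb => /eqP->.
    exact: ideal0.
  exact: (ideal0 (ideal_gen_ideal _)).
have principal x : I x -> exists2 C, is_ideal C &
    [set x * s | s in setT] = ideal_mul I C.
  have [I' [d invI]] := dedekind_inverse dedS iI Ia a0.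
  move=> Ix; apply: (ideal_dvd invI); first exact/ideal_image_mul/idealT.
  by move=> _ [s _ <-]; apply: idealMr.
have mem_principal x : [set x * s | s in setT] x.
  by exists 1 => //; rewrite mulr1.
have [J iJ eJ] := principal a Ia.
have Ja : J a by apply: (@ideal_mul_subr _ I _ iJ); rewrite -eJ.
have [Ps maxPs PsJ] := dedekind_ideal_prod iJ Ja a0.
have [b Ib bPs] := avoid_maximal_ideals iI Ia a0 maxPs.
have [C iC eC] := principal b Ib.
have iJC := ideal_add_ideal iJ iC.
(* A maximal [M] containing [J + C] contains the product of [Ps], so it occurs in [Ps]; but [b] is
   in [I C], hence in [I M], against the choice of [b]. *)
have [j Jj [c Cc jc1]] : ideal_add J C 1.
  apply: contrapT => nJC1.
  have [M maxM JCM] :=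
    noetherian_maximal_ideal dedekind_noetherian iJC nJC1.
  apply: (bPs M).
    apply: maximal_ideal_prod => //; apply: subset_trans PsJ _.
    exact: subset_trans (@ideal_addl _ _ _ iC) JCM.
  apply: (@ideal_mulS _ I C M); last by rewrite -eC.
  exact: subset_trans (@ideal_addr _ _ _ iJ) JCM.
exists a, b; apply/seteqP; split.
  by apply: ideal_gen_sub => // x; rewrite /= !inE => /orP[]/eqP->.
move=> x Ix; have iab := ideal_gen_ideal [set` [:: a; b]].
(* [x = x * j + x * c], with [x * j] in [I J = a S] and [x * c] in [I C = b S]. *)
rewrite -[x]mulr1 -jc1 mulrDr; apply: (idealD iab).
  have : ideal_mul I J (x * j) by apply: mem_ideal_mul.
  rewrite -eJ => -[s _ <-]; apply: (idealMr _ iab).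
  by apply: sub_ideal_gen; rewrite /= !inE eqxx.
have : ideal_mul I C (x * c) by apply: mem_ideal_mul.
rewrite -eC => -[s _ <-]; apply: (idealMr _ iab).
by apply: sub_ideal_gen; rewrite /= !inE eqxx orbT.
Qed.

End DedekindSemidomain.

Local Close Scope classical_set_scope.

Theorem theorem3p35 (R : realType) (S : semidomainType) :
  subtractive S -> dedekind_semidomain S -> (mu_star S R <= 2%:R%:E)%E.
Proof.
move=> subS dedS; apply: ge_ereal_sup => _ [I iI <-].
have [a [b abI]] := dedekind_two_generators subS dedS iI.
(* [mu] is an infimum of list lengths, so one generating list of length two bounds it. *)
by apply: ereal_inf_lbound; exists [:: a; b].
Qed.
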